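(* Let $n>3$, and let $\Phi_n:\mathfrak{so}(n,\mathbb{C})\to\mathbb{C}^{r_{n-1}}\oplus\mathbb{C}^{r_n}$ be the orthogonal partial Kostant-Wallach map. Then $\Phi_n^{-1}(0,0)$ contains no $n$-strongly regular elements.
   Context: Let $\mathfrak{g}=\mathfrak{so}(n,\mathbb{C})$ be the Lie algebra of a nondegenerate symmetric bilinear form on $\mathbb{C}^n$, $G=SO(n,\mathbb{C})$, $\mathfrak{k}=\mathfrak{so}(n-1,\mathbb{C})$ the annihilator in $\mathfrak{g}$ of a fixed non-isotropic vector (the fixed points of the involution $\theta$ given by conjugation by the orthogonal reflection in that vector), $K=SO(n-1,\mathbb{C})$ the corresponding connected subgroup, and $x_{\mathfrak{k}}$ the projection of $x\in\mathfrak{g}$ onto $\mathfrak{k}$ along the $-1$-eigenspace of $\theta$. Let $r_m=\lfloor m/2\rfloor$. Let $f_{n,1},\dots,f_{n,r_n}$ be algebraically independent homogeneous generators of $\mathbb{C}[\mathfrak{g}]^G$ and $f_{n-1,1},\dots,f_{n-1,r_{n-1}}$ algebraically independent homogeneous generators of $\mathbb{C}[\mathfrak{k}]^K$. Then $\Phi_n(x)=(f_{n-1,1}(x_{\mathfrak{k}}),\dots,f_{n-1,r_{n-1}}(x_{\mathfrak{k}}),f_{n,1}(x),\dots,f_{n,r_n}(x))$. An element $x\in\mathfrak{g}$ is $n$-strongly regular if $\mathfrak{z}_{\mathfrak{k}}(x_{\mathfrak{k}})\cap\mathfrak{z}_{\mathfrak{g}}(x)=0$, where $\mathfrak{z}$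 denotes the centralizer. *)

(* Defs.v *)
From HB Require Import structures.
From mathcomp Require Import all_boot all_order all_algebra.
From mathcomp Require Export reals.
From mathcomp.real_closed Require Export complex.
From mathcomp Require Export mpoly.

Set Implicit Arguments.
Unset Strict Implicit.
Unset Printing Implicit Defensive.

Import GRing.Theory Num.Theory.
Local Open Scope ring_scope.

Section OrthogonalPair.

Variables (F : numFieldType) (n : nat).
Implicit Types (B x y g : 'M[F]_n) (v : 'cV[F]_n).

(* Vectors are columns; the bilinear form with Gram matrix B is u^T B w. *)
Definition bform B (u w : 'cV[F]_n) : F := (u^T *m B *m w) 0 0.

Definition so_eqn B x := x^T *m B + B *m x.
Fact so_eqn_linear B : linear (so_eqn B).
Proof.
move=> a x y; rewrite /so_eqn linearP mulmxDl mulmxDr -scalemxAl -scalemxAr.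
by rewrite scalerDr addrACA.
Qed.
HB.instance Definition _ B :=
  GRing.isLinear.Build F 'M_n 'M_n _ (so_eqn B) (so_eqn_linear B).

Definition annih_eqn v x := x *m v.
Fact annih_eqn_linear v : linear (annih_eqn v).
Proof. by move=> a x y; rewrite /annih_eqn mulmxDl -scalemxAl. Qed.
HB.instance Definition _ v :=
  GRing.isLinear.Build F 'M_n 'cV_n _ (annih_eqn v) (annih_eqn_linear v).

Definition bracket x y := x *m y - y *m x.
Fact bracket_linear x : linear (bracket x).
Proof.
move=> a y z; rewrite /bracket mulmxDr mulmxDl -scalemxAl -scalemxAr.
by rewrite scalerBr opprD addrACA.
Qed.
HB.instance Definition _ x :=
  GRing.isLinear.Build F 'M_n 'M_n _ (bracket x) (bracket_linear x).

Definition reflection B v : 'M[F]_n :=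
  1%:M - (2 / bform B v v) *: (v *m v^T *m B).

Definition theta B v x := reflection B v *m x *m invmx (reflection B v).
Fact theta_linear B v : linear (theta B v).
Proof.
by move=> a x y; rewrite /theta mulmxDr mulmxDl -scalemxAr -scalemxAl.
Qed.
HB.instance Definition _ B v :=
  GRing.isLinear.Build F 'M_n 'M_n _ (theta B v) (theta_linear B v).

Definition so B : {vspace 'M[F]_n} := lker (linfun (so_eqn B)).

Definition so_k B v : {vspace 'M[F]_n} := (so B :&: lker (linfun (annih_eqn v)))%VS.

Definition so_p B v : {vspace 'M[F]_n} :=
  (so B :&: passmx.leigenspace (linfun (theta B v)) (-1))%VS.

Definition proj_k B v x : 'M[F]_n := daddv_pi (so_k B v) (so_p B v) x.

Definition centralizer (U : {vspace 'M[F]_n}) x : {vspace 'M[F]_n} :=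
  (U :&: lker (linfun (bracket x)))%VS.

Definition strongly_regular B v x : Prop :=
  (centralizer (so_k B v) (proj_k B v x) :&: centralizer (so B) x = 0)%VS.

Definition SO B : pred 'M[F]_n := [pred g | (g^T *m B *m g == B) && (\det g == 1)].

(* The stabilizer of v in SO(B) acts faithfully on the orthogonal complement of
   v as its special orthogonal group; it is the connected subgroup with Lie
   algebra so_k B v. *)
Definition SO_K B v : pred 'M[F]_n := [pred g | (g \in SO B) && (g *m v == v)].

(* Elements of the coordinate ring of a subspace U of n x n matrices are
   represented by functions on all matrices, of which only the values on U
   matter; a polynomial function on U is the restriction of a polynomial in the
   matrix entries. *)
Definition entries x (i : 'I_(n * n)) : F := mxvec x 0 i.

Definition poly_fun (U : {vspace 'M[F]_n}) (h : 'M[F]_n -> F) : Prop :=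
  exists p : {mpoly F[n * n]}, forall x, x \in U -> h x = p.@[entries x].

Definition homog_fun (U : {vspace 'M[F]_n}) (h : 'M[F]_n -> F) : Prop :=
  exists (d : nat) (p : {mpoly F[n * n]}),
    p \is d.-homog /\ forall x, x \in U -> h x = p.@[entries x].

Definition invariant_fun (H : pred 'M[F]_n) (U : {vspace 'M[F]_n})
    (h : 'M[F]_n -> F) : Prop :=
  forall g x, g \in H -> x \in U -> h (g *m x *m invmx g) = h x.

Record free_invariant_generators (H : pred 'M[F]_n) (U : {vspace 'M[F]_n})
    (r : nat) (f : 'I_r -> 'M[F]_n -> F) : Prop := FreeInvariantGenerators {
  gen_homog : forall i, homog_fun U (f i);
  gen_invariant : forall i, invariant_fun H U (f i);
  gen_generate : forall h, poly_fun U h -> invariant_fun H U h ->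
    exists q : {mpoly F[r]}, forall x, x \in U -> h x = q.@[fun i => f i x];
  gen_alg_indep : forall q : {mpoly F[r]},
    (forall x, x \in U -> q.@[fun i => f i x] = 0) -> q = 0 }.

Definition partial_KW B v (r' r : nat) (fk : 'I_r' -> 'M[F]_n -> F)
    (f : 'I_r -> 'M[F]_n -> F) x : 'rV[F]_r' * 'rV[F]_r :=
  (\row_i fk i (proj_k B v x), \row_i f i x).

Lemma mem_so B x : (x \in so B) = (x^T *m B + B *m x == 0).
Proof. by rewrite memv_ker lfunE. Qed.

Lemma mem_so_k B v x : (x \in so_k B v) = (x \in so B) && (x *m v == 0).
Proof. by rewrite memv_cap memv_ker lfunE. Qed.

Lemma mem_so_p B v x : (x \in so_p B v) = (x \in so B) && (theta B v x == - x).
Proof.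
rewrite memv_cap; congr (_ && _); rewrite memv_ker !lfun_simp /=.
by rewrite scaleN1r opprK addr_eq0.
Qed.

Lemma mem_centralizer (U : {vspace 'M[F]_n}) x y :
  (y \in centralizer U x) = (y \in U) && (x *m y == y *m x).
Proof. by rewrite memv_cap memv_ker lfunE /= subr_eq0. Qed.

Section Involution.

Variables (B : 'M[F]_n) (v : 'cV[F]_n).
Hypotheses (Bsym : B^T = B) (vB : bform B v v != 0).
Let s := reflection B v.
Let b := bform B v v.

Let vBv : v^T *m B *m v = b%:M.
Proof. exact: mx11_scalar. Qed.

Lemma reflection_v : s *m v = - v.
Proof.
rewrite /s /reflection mulmxBl mul1mx -scalemxAl -!mulmxA (mulmxA v^T) vBv.
rewrite mul_mx_scalar scalerA divfK // scaler_nat mulr2n opprD addrA subrr.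
by rewrite sub0r.
Qed.

Lemma reflectionK : s *m s = 1%:M.
Proof.
rewrite {2}/s /reflection mulmxBr mulmx1 -scalemxAr !mulmxA reflection_v.
rewrite !mulNmx scalerN opprK /s /reflection subrK //.
Qed.

Lemma reflection_unit : s \in unitmx.
Proof. by case: (mulmx1_unit reflectionK). Qed.

Lemma thetaE x : theta B v x = s *m x *m s.
Proof.
rewrite /theta -/s; congr (_ *m _).
by rewrite -[LHS]mulmx1 -reflectionK mulmxA mulVmx ?mul1mx // reflection_unit.
Qed.

Lemma thetaK x : theta B v (theta B v x) = x.
Proof. by rewrite !thetaE !mulmxA reflectionK mul1mx -mulmxA reflectionK mulmx1. Qed.

Lemma reflection_form : s^T *m B = B *m s.
Proof.
rewrite /s /reflection linearB /= trmx1 linearZ /= !trmx_mul trmxK Bsym.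
by rewrite mulmxBl mulmxBr mul1mx mulmx1 -scalemxAl -scalemxAr !mulmxA.
Qed.

Lemma theta_so x : x \in so B -> theta B v x \in so B.
Proof.
rewrite !mem_so thetaE !trmx_mul !addr_eq0 => /eqP h.
rewrite -!mulmxA reflection_form (mulmxA x^T) h !mulmxA -reflection_form.
by rewrite !mulmxN !mulNmx !mulmxA.
Qed.

Lemma so_k_fixed x : (x \in so_k B v) = (x \in so B) && (theta B v x == x).
Proof.
rewrite mem_so_k; case xso: (x \in so B) => //=.
have vBx y : y \in so B -> y *m v = 0 -> v^T *m B *m y = 0.
  rewrite mem_so addr_eq0 => /eqP h yv.
  by rewrite -mulmxA -[B *m y]opprK -h mulmxN mulmxA -trmx_mul yv trmx0 mul0mx oppr0.
apply/eqP/eqP=> [xv|tx].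
  rewrite thetaE /s /reflection mulmxBl mul1mx -scalemxAl -!mulmxA (mulmxA v^T).
  rewrite vBx // mulmx0 scaler0 subr0 mulmxBr mulmx1 -scalemxAr !mulmxA.
  by rewrite xv !mul0mx scaler0 subr0.
(* x commutes with s, so s (x v) = - x v; skewness gives s (x v) = x v. *)
have sx : s *m x = x *m s by rewrite -{2}tx thetaE -!mulmxA reflectionK mulmx1.
have sxv : s *m (x *m v) = - (x *m v).
  by rewrite mulmxA sx -mulmxA reflection_v mulmxN.
have skew : v^T *m B *m (x *m v) = 0.
  move: xso; rewrite mem_so addr_eq0 => /eqP h.
  set t := LHS; have tT : t^T = t by apply/matrixP=> i j; rewrite mxE !ord1.
  have : t = - t.
    rewrite -{1}tT /t !trmx_mul trmxK Bsym -!mulmxA (mulmxA x^T) h.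
    by rewrite mulNmx mulmxN !mulmxA.
  move/eqP; rewrite -subr_eq0 opprK -mulr2n -scaler_nat scaler_eq0 pnatr_eq0 /=.
  by move/eqP.
move: sxv; rewrite {1}/s /reflection mulmxBl mul1mx -scalemxAl -!(mulmxA v).
rewrite skew mulmx0 scaler0 subr0 => /eqP.
rewrite -subr_eq0 opprK -mulr2n -scaler_nat scaler_eq0 pnatr_eq0 /=.
by move/eqP.
Qed.

Lemma so_k_p_disjoint : (so_k B v :&: so_p B v = 0)%VS.
Proof.
apply/eqP; rewrite -subv0; apply/subvP=> x; rewrite memv_cap so_k_fixed mem_so_p.
case/andP=> /andP[_ /eqP ->] /andP[_]; rewrite memv0.
by rewrite -subr_eq0 opprK -mulr2n -scaler_nat scaler_eq0 pnatr_eq0.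
Qed.

Lemma proj_kE x : x \in so B -> proj_k B v x = 2^-1 *: (x + theta B v x).
Proof.
move=> xso; have t2 : (2 : F) != 0 by rewrite pnatr_eq0.
set y := RHS; set z := 2^-1 *: (x - theta B v x).
have yk : y \in so_k B v.
  rewrite so_k_fixed memvZ ?memvD ?theta_so //=.
  by rewrite linearZ linearD /= thetaK addrC.
have zp : z \in so_p B v.
  rewrite mem_so_p memvZ ?memvB ?theta_so //=.
  by rewrite linearZ linearB /= thetaK -scalerN opprB.
have xyz : x = y + z.
  by rewrite -scalerDr addrACA subrr addr0 -mulr2n -scaler_nat scalerA mulVf ?scale1r.
have d := so_k_p_disjoint; have d' : (so_p B v :&: so_k B v = 0)%VS by rewrite capvC.
rewrite /proj_k [in LHS]xyz linearD /= daddv_pi_id //.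
have := daddv_pi_add d (subvP (addvSr _ _) _ zp).
rewrite (daddv_pi_id d' zp) => /eqP; rewrite -subr_eq0 addrK => /eqP ->.
by rewrite addr0.
Qed.

End Involution.

End OrthogonalPair.

(* Main.v *)
(**
Write b for the form, beta = b(v,v), y = x_k and w = x v, a vector of W = v^perp;
then x = y + beta^-1 (w /\ v), where (a /\ c) u = b(c,u) a - b(a,u) c.  The
coefficients of the characteristic polynomial are invariant, so on the zero
fibre x and y are both nilpotent.  The polynomials
alpha(t) = sum_k b(v, x^k v) t^k / beta and
g(t) = 1 + sum_k b(w, y^k w) t^(k+2) / beta satisfy alpha g = 1 (Schur
complement of 1 - t y in 1 - t x), so g = 1: the vectors w, y w, y^2 w, ... span
an isotropic subspace of W.

An element z of so(W) that commutes with y and kills w commutes with x.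
If y w <> 0, let e >= 2 be least with y^e w = 0 and take
z = (y^(e-1) w) /\ (y^(e-2) w).  If y w = 0 but y <> 0, take z = y.  If y = 0,
take z = a /\ c with a, c independent and orthogonal to v and w; here n > 3 is
used.
*)
Require Import Defs.
From mathcomp Require Import all_boot all_order all_algebra.
Import GRing.Theory Num.Theory.
Local Open Scope ring_scope.
Local Open Scope complex_scope.

Set Implicit Arguments.
Unset Strict Implicit.
Unset Printing Implicit Defensive.

(** * Invariant polynomials on the zero fibre *)

Section Invariants.

Variables (F : numFieldType) (n : nat).
Implicit Types (B x g : 'M[F]_n) (v : 'cV[F]_n) (U : {vspace 'M[F]_n}).

(** If [d > 0], every monomial of [p] contains a variable; if [d = 0], only the trivial monomial
    occurs. *)
Lemma homog_meval_cases m d (p : {mpoly F[m]}) : p \is d.-homog ->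
  p.@[fun=> 0] = 0 \/ forall u, p.@[u] = p.@[fun=> 0].
Proof.
move=> /dhomogP hp; case: (posnP d) => [d0|dgt0]; [right => u | left].
  rewrite !mevalE; apply: eq_big_seq => m' /hp /eqP.
  rewrite d0 mdeg_eq0 => /eqP ->; congr (_ * _); apply: eq_bigr => i _.
  by rewrite mnm0E !expr0.
rewrite mevalE big_seq big1 // => m' /hp dm'.
have [i mi0] : exists i, m' i != 0%N.
  apply/existsP; apply: contraLR dgt0; rewrite negb_exists => /forallP h.
  rewrite -dm' -leqNgt leqn0 /= mdegE sum_nat_eq0; apply/forallP => i.
  by have := h i; rewrite negbK.
by rewrite (bigD1 i) //= expr0n (negPf mi0) mul0r mulr0.
Qed.

Lemma entries0 : entries (0 : 'M[F]_n) =1 fun=> 0.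
Proof. by move=> i; rewrite /entries linear0 mxE. Qed.

Lemma free_generators_at0 (H : pred 'M[F]_n) U r (f : 'I_r -> 'M[F]_n -> F) :
  free_invariant_generators H U f -> forall i, f i 0 = 0.
Proof.
case=> fhom _ _ findep i; have [d [p [/homog_meval_cases pd fp]]] := fhom i.
have f0 : f i 0 = p.@[fun=> 0] by rewrite fp ?mem0v // (meval_eq _ entries0).
case: pd => [//|pc]; first by rewrite f0.
(* Otherwise f i is a constant c, against the algebraic independence. *)
set c := f i 0.
have /(congr1 (meval (fun=> c + 1))) : 'X_i - c%:MP = 0 :> {mpoly F[r]}.
  apply: findep => x xU; rewrite mevalB mevalXU mevalC fp // pc -f0.
  by rewrite subrr.
rewrite mevalB mevalXU mevalC meval0 addrAC subrr add0r => /eqP.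
by rewrite oner_eq0.
Qed.

(** The generators agree at [x] and at 0, hence so does any polynomial in them. *)
Lemma invariant_zero_fibre (H : pred 'M[F]_n) U r (f : 'I_r -> 'M[F]_n -> F) x h :
  free_invariant_generators H U f -> x \in U -> (forall i, f i x = 0) ->
  poly_fun U h -> invariant_fun H U h -> h x = h 0.
Proof.
move=> fgen xU fx0 hpoly hinv; have f0 := free_generators_at0 fgen.
have [q hq] := gen_generate fgen hpoly hinv.
by rewrite !hq ?mem0v //; apply: meval_eq => i; rewrite fx0 f0.
Qed.

Lemma char_poly_conj g x : g \in unitmx ->
  char_poly (g *m x *m invmx g) = char_poly x.
Proof.
move=> gu; set P := map_mx polyC g; set Q := map_mx polyC (invmx g).
have PQ : P *m Q = 1%:M by rewrite -map_mxM mulmxV // map_mx1.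
have -> : char_poly (g *m x *m invmx g) = \det (P *m char_poly_mx x *m Q).
  congr (\det _); rewrite /char_poly_mx !map_mxM -/P -/Q mulmxBr mulmxBl.
  by rewrite scalar_mxC -(mulmxA 'X%:M) PQ mulmx1.
by rewrite !det_mulmx mulrAC -det_mulmx PQ det1 mul1r.
Qed.

Lemma poly_fun_char_poly_coef U k : poly_fun U (fun x => (char_poly x)`_k).
Proof.
(* [X] is the generic matrix, which specializes to [x]; forming [char_poly] commutes with
   specialization. *)
pose X : 'M[{mpoly F[n * n]}]_n := \matrix_(i, j) 'X_(mxvec_index i j).
exists (char_poly X)`_k => x _.
have {1}<- : map_mx (meval (entries x)) X = x.
  by apply/matrixP=> i j; rewrite !mxE mevalXU /entries mxvecE.
by rewrite -map_char_poly coef_map.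
Qed.

Lemma char_poly_zero_fibre (H : pred 'M[F]_n) U r (f : 'I_r -> 'M[F]_n -> F) x :
  {subset H <= unitmx} -> free_invariant_generators H U f -> x \in U ->
  (forall i, f i x = 0) -> char_poly x = 'X^n.
Proof.
move=> Hu fgen xU fx0; transitivity (char_poly (0 : 'M[F]_n)).
  apply/polyP=> k; apply: (invariant_zero_fibre (h := fun z => (char_poly z)`_k) fgen xU fx0).
    exact: poly_fun_char_poly_coef.
  by move=> g z gH _; rewrite char_poly_conj // Hu.
by rewrite /char_poly /char_poly_mx map_mx0 subr0 det_scalar.
Qed.

End Invariants.

Lemma char_poly_nilpotent (F : fieldType) n (x : 'M[F]_n.+1) :
  char_poly x = 'X^(n.+1) -> x ^+ n.+1 = 0.
Proof.
by move=> cx; have := Cayley_Hamilton x; rewrite cx rmorphXn /= horner_mx_X.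
Qed.

(** * The bilinear form and the skew operators [wedge a c] *)

Section Wedge.

Variables (F : numFieldType) (n : nat) (B : 'M[F]_n).
Implicit Types (x y z : 'M[F]_n) (a c u : 'cV[F]_n).

Lemma bformE a u : a^T *m B *m u = (bform B a u)%:M.
Proof. exact: mx11_scalar. Qed.

Lemma bformDr a c u : bform B u (a + c) = bform B u a + bform B u c.
Proof. by rewrite /bform mulmxDr mxE. Qed.

Lemma bformZr k a u : bform B u (k *: a) = k * bform B u a.
Proof. by rewrite /bform -scalemxAr mxE. Qed.

Lemma bform0r u : bform B u 0 = 0.
Proof. by rewrite /bform mulmx0 mxE. Qed.

Lemma bform_sumr m a (c : 'I_m -> 'cV[F]_n) :
  bform B a (\sum_i c i) = \sum_i bform B a (c i).
Proof. by rewrite /bform mulmx_sumr summxE. Qed.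

Lemma bform_so y a c : y \in so B -> bform B (y *m a) c = - bform B a (y *m c).
Proof.
rewrite mem_so addr_eq0 => /eqP h.
by rewrite /bform trmx_mul -(mulmxA a^T y^T) h mulmxN !mulNmx mxE !mulmxA.
Qed.

Hypothesis Bsym : B^T = B.

Lemma bformC a c : bform B a c = bform B c a.
Proof.
transitivity ((a^T *m B *m c)^T 0 0); first by rewrite [RHS]mxE.
by rewrite !trmx_mul trmxK Bsym mulmxA.
Qed.

Definition wedge a c : 'M[F]_n := a *m (c^T *m B) - c *m (a^T *m B).

Lemma wedge_mul a c u : wedge a c *m u = bform B c u *: a - bform B a u *: c.
Proof. by rewrite /wedge mulmxBl -!mulmxA !(mulmxA _^T) !bformE !mul_mx_scalar. Qed.

Lemma wedge_so a c : wedge a c \in so B.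
Proof.
rewrite mem_so /wedge linearB /= !trmx_mul !trmxK Bsym mulmxBl mulmxBr !mulmxA.
by rewrite addrC subrKA subrr.
Qed.

(** The Lie algebra acts on the exterior square by derivations. *)
Lemma bracket_wedge y a c : y \in so B ->
  y *m wedge a c - wedge a c *m y = wedge (y *m a) c + wedge a (y *m c).
Proof.
rewrite mem_so addr_eq0 => /eqP h.
rewrite /wedge mulmxBr mulmxBl !trmx_mul -!(mulmxA _^T) h !mulmxN !mulmxA.
rewrite opprB opprK -!addrA; congr (_ + _).
by rewrite addrC -addrA.
Qed.

Hypothesis Bunit : B \in unitmx.

Lemma bform_nondeg a : a != 0 -> exists u, bform B a u != 0.
Proof.
move=> a0; have /rV0Pn[i ai] : a^T *m B != 0.
  apply: contraNneq a0 => h; rewrite -[a]trmxK -[a^T]mulmx1.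
  by rewrite -(mulmxV Bunit) mulmxA h mul0mx trmx0.
by exists (delta_mx i 0); rewrite /bform -colE mxE.
Qed.

(** Applying [wedge a c] to a vector not orthogonal to [a] lets one solve for [c]. *)
Lemma wedge_eq0 a c : a != 0 -> wedge a c = 0 -> exists k, c = k *: a.
Proof.
move=> /bform_nondeg[u au] /(congr1 (mulmx^~ u)).
rewrite wedge_mul mul0mx => /eqP; rewrite subr_eq0 => /eqP h.
exists ((bform B a u)^-1 * bform B c u).
by rewrite -scalerA h scalerA mulVf // scale1r.
Qed.

(** Expand [theta B v x] with the reflection written as [1 - (2 / b) P]: the term [P x P] vanishes
    because [x v] is orthogonal to [v], and [x P + P x] is the wedge. *)
Lemma proj_kE_wedge v x : bform B v v != 0 -> x \in so B ->
  x = proj_k B v x + (bform B v v)^-1 *: wedge (x *m v) v.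
Proof.
move=> vB xso; rewrite proj_kE // thetaE // /reflection.
set b := bform B v v; set P := v *m v^T *m B; set w := x *m v.
have b2 : 2^-1 * (2 / b) = b^-1 by rewrite mulrA mulVf ?mul1r ?pnatr_eq0.
have wv : w^T *m B *m v = 0.
  rewrite bformE; suff -> : bform B w v = 0 by rewrite raddf0.
  have /eqP := bform_so v v xso; rewrite -/w (bformC v).
  by rewrite -subr_eq0 opprK -mulr2n mulrn_eq0 => /eqP.
have Px : P *m x = - (v *m (w^T *m B)).
  move: xso; rewrite mem_so addr_eq0 => /eqP h.
  by rewrite /P /w trmx_mul -(mulmxA v^T x^T) h -!mulmxA !mulmxN opprK.
have xP : x *m P = w *m (v^T *m B) by rewrite /P /w !mulmxA.
have PxP : P *m x *m P = 0.
  rewrite Px mulNmx /P -!mulmxA (mulmxA w^T) (mulmxA (w^T *m B)) wv.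
  by rewrite mul0mx mulmx0 oppr0.
have -> : wedge w v = x *m P + P *m x by rewrite xP Px.
rewrite mulmxBl mul1mx mulmxBr mulmx1 -scalemxAl -scalemxAr mulmxBl -scalemxAl.
rewrite PxP scaler0 subr0 addrA addrA -mulr2n -scaler_nat.
rewrite !scalerBr !scalerA !b2 mulVf ?pnatr_eq0 // scale1r scalerDr.
by rewrite addrA !subrK.
Qed.

End Wedge.

(** The units of a polynomial ring over a field are constants. *)
Lemma poly_mul1_coefS (F : fieldType) (p q : {poly F}) k :
  p * q = 1 -> q`_k.+1 = 0.
Proof.
move=> pq1; have : q \is a GRing.unit by apply/unitrPr; exists p; rewrite mulrC.
by rewrite poly_unitE => /andP[/eqP sq _]; rewrite nth_default ?sq.
Qed.

(** * Isotropy of the cyclic subspace generated by [w] under [y] *)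

Section Isotropy.

Variables (F : numFieldType) (n : nat) (B x y : 'M[F]_n.+1) (v w : 'cV[F]_n.+1).
Let b := bform B v v.
Hypotheses (Bsym : B^T = B) (b0 : b != 0) (yso : y \in so B) (yv : y *m v = 0).
Hypotheses (wv : bform B w v = 0) (xE : x = y + b^-1 *: wedge B w v).

Lemma bform_expr_v k : bform B v (y ^+ k *m w) = 0.
Proof.
case: k => [|k]; first by rewrite expr0 mul1mx bformC.
rewrite exprS -mulmxE -mulmxA; apply/eqP; rewrite -oppr_eq0 -bform_so // yv.
by rewrite bformC // bform0r.
Qed.

Let alpha k := b^-1 * bform B v (x ^+ k *m v).
Let gamma k := b^-1 * bform B w (y ^+ k *m w).
(** The component of [x ^+ k *m v] orthogonal to [v], as [expr_v] shows. The sum is empty at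
    [k = 0], so the truncated [k.-1] is harmless. *)
Let U k := \sum_(i < k) alpha i *: (y ^+ (k.-1 - i) *m w).

Let bvU k : bform B v (U k) = 0.
Proof.
by rewrite bform_sumr big1 // => i _; rewrite bformZr bform_expr_v mulr0.
Qed.

Let xu u : bform B v u = 0 -> x *m u = y *m u - (b^-1 * bform B w u) *: v.
Proof.
move=> vu; rewrite xE mulmxDl -scalemxAl wedge_mul // vu scale0r sub0r scalerN.
by rewrite scalerA.
Qed.

Let xv : x *m v = w.
Proof.
rewrite xE mulmxDl -scalemxAl wedge_mul // yv add0r wv scale0r subr0 scalerA.
by rewrite mulVf // scale1r.
Qed.

Let US k : U k.+1 = alpha k *: w + y *m U k.
Proof.
rewrite /U big_ord_recr /= subnn expr0 mul1mx addrC mulmx_sumr; congr (_ + _).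
apply: eq_bigr => i _; rewrite -scalemxAr mulmxA mulmxE -exprS.
by case: k i => [[]//|k] i; rewrite subSn // -ltnS ltn_ord.
Qed.

Let alpha0 : alpha 0 = 1.
Proof. by rewrite /alpha expr0 mul1mx mulVf. Qed.

Let alphaE k c : x ^+ k *m v = c *: v + U k -> alpha k = c.
Proof.
by move=> h; rewrite /alpha h bformDr bformZr bvU addr0 mulrCA mulVf ?mulr1.
Qed.

Let expr_vS k : x ^+ k *m v = alpha k *: v + U k ->
  x ^+ k.+1 *m v = - (b^-1 * bform B w (U k)) *: v + U k.+1.
Proof.
move=> h; rewrite exprS -mulmxE -mulmxA h mulmxDr -scalemxAr xv xu // US.
by rewrite scaleNr addrA addrC.
Qed.

Let expr_v k : x ^+ k *m v = alpha k *: v + U k.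
Proof.
elim: k => [|k /expr_vS h]; last by rewrite (alphaE h).
by rewrite expr0 mul1mx alpha0 scale1r /U big_ord0 addr0.
Qed.

Let alphaS k : alpha k.+1 = - (b^-1 * bform B w (U k)).
Proof. exact/alphaE/expr_vS/expr_v. Qed.

Let alpha1 : alpha 1 = 0.
Proof. by rewrite alphaS /U big_ord0 bform0r mulr0 oppr0. Qed.

(** This is the coefficient of degree [k + 2] in [alpha g = 1]. *)
Let alphaSS k : alpha k.+2 = - \sum_(i < k.+1) alpha i * gamma (k - i).
Proof.
rewrite alphaS bform_sumr mulr_sumr; congr (- _); apply: eq_bigr => i _.
by rewrite bformZr mulrCA.
Qed.

(** Nilpotency turns the power series [alpha] and [g] into polynomials, so [alpha g = 1] makes [g] a
    unit, that is, a constant. *)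
Lemma cyclic_isotropic M k :
  x ^+ M = 0 -> y ^+ M = 0 -> bform B w (y ^+ k *m w) = 0.
Proof.
move=> xM yM.
have expr_ge (z : 'M[F]_n.+1) j : z ^+ M = 0 -> (M <= j)%N -> z ^+ j = 0.
  by move=> zM /subnK <-; rewrite exprD zM mulr0.
(* Truncation at [M] loses nothing, the later coefficients being zero. *)
have coefp (z : 'M[F]_n.+1) a c j : z ^+ M = 0 ->
    (\poly_(i < M) (b^-1 * bform B a (z ^+ i *m c)))`_j =
    b^-1 * bform B a (z ^+ j *m c).
  move=> zM; rewrite coef_poly; case: ltnP => // Mj.
  by rewrite (expr_ge _ _ zM Mj) mul0mx bform0r mulr0.
pose A : {poly F} := \poly_(i < M) alpha i.
pose G : {poly F} := \poly_(i < M) gamma i.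
have AG : A * (1 + G * 'X^2) = 1.
  apply/polyP=> j; rewrite mulrDr mulr1 mulrA coefD coefMXn coef1 coefp //.
  case: j => [|[|j]] /=; rewrite ?addr0; [exact: alpha0 | exact: alpha1 |].
  rewrite -/(alpha _) alphaSS subn2 /= coefM; apply/eqP; rewrite addrC subr_eq0.
  by apply/eqP/eq_bigr => i _; rewrite !coefp.
have := poly_mul1_coefS k.+1 AG.
rewrite coefD coef1 add0r coefMXn subn2 /= coefp // => /eqP.
by rewrite mulf_eq0 invr_eq0 (negPf b0) => /eqP.
Qed.

End Isotropy.

(** * A nonzero element in both centralizers *)

Section CommutingElement.

Variables (F : numFieldType) (n : nat) (B : 'M[F]_n.+1).
Hypotheses (Bsym : B^T = B) (Bunit : B \in unitmx).
Implicit Types (y z : 'M[F]_n.+1) (a c v w : 'cV[F]_n.+1).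

(** Two linear conditions on a space of dimension [n.+1 > 3] leave a solution space of dimension at
    least 2. *)
Lemma independent_orthogonal_pair v w : (2 < n)%N ->
  exists a c, [/\ a != 0, forall k, c != k *: a &
    [/\ bform B a v = 0, bform B a w = 0, bform B c v = 0 & bform B c w = 0]].
Proof.
move=> n3; pose M := row_mx (B *m v) (B *m w); pose K := kermx M.
have rK : (1 < \rank K)%N.
  rewrite mxrank_ker ltn_subRL (leq_trans (n := 3.+1)) // addn1 ltnS.
  exact: leq_trans (rank_leq_col M) _.
have Kort (r : 'rV_n.+1) : (r <= K)%MS -> bform B r^T v = 0 /\ bform B r^T w = 0.
  move/sub_kermxP; rewrite mul_mx_row -[0](hsubmxK) linear0 linear0.
  case/eq_row_mx=> rv rw; rewrite /bform trmxK -!mulmxA rv rw.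
  by rewrite !mxE.
have a0 : nz_row K != 0.
  by rewrite nz_row_eq0 -mxrank_eq0 -lt0n ltnW.
have : ~~ (K <= nz_row K)%MS.
  by apply: contraL rK => /mxrankS h; rewrite -leqNgt (leq_trans h) ?rank_leq_row.
case/row_subPn=> i ci; exists (nz_row K)^T, (row i K)^T.
have [av aw] := Kort _ (nz_row_sub K); have [cv cw] := Kort _ (row_sub i K).
split=> // [|k]; first by rewrite trmx_eq0.
apply: contra ci => /eqP /(congr1 trmx); rewrite linearZ /= !trmxK => ->.
exact: scalemx_sub.
Qed.

Lemma exists_commuting_so_annihilator y v w M : (2 < n)%N -> y \in so B ->
  y *m v = 0 -> bform B w v = 0 -> y ^+ M = 0 ->
  (forall k, bform B w (y ^+ k *m w) = 0) ->
  exists z, [/\ z != 0, z \in so B, z *m v = 0, z *m w = 0 & y *m z = z *m y].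
Proof.
move=> n3 yso yv wv yM wyw.
have [->|y0] := eqVneq y 0.
  have [a [c [a0 ca [av aw cv cw]]]] := independent_orthogonal_pair v w n3.
  exists (wedge B a c); rewrite wedge_so // !wedge_mul // av aw cv cw !scale0r subr0.
  split=> //; last by rewrite mul0mx mulmx0.
  apply/eqP => /(wedge_eq0 Bunit a0)[k ck].
  by have := ca k; rewrite ck eqxx.
have [yw|yw] := eqVneq (y *m w) 0; first by exists y.
have ex_e : exists e, y ^+ e *m w == 0 by exists M; rewrite yM mul0mx.
(* The exponents 0 and 1 are excluded by [y *m w != 0], so the least one is [e.+2]. *)
case: (ex_minnP ex_e) => [[|[|e]]] /eqP ye emin.
- by move: ye yw; rewrite expr0 mul1mx => ->; rewrite mulmx0 eqxx.
- by rewrite -{1}(expr1 y) ye eqxx in yw.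
have ySl k : y *m (y ^+ k *m w) = y ^+ k.+1 *m w.
  by rewrite mulmxA mulmxE -exprS.
have l0 : y ^+ e.+1 *m w != 0 by apply/negP=> /emin; rewrite ltnn.
exists (wedge B (y ^+ e.+1 *m w) (y ^+ e *m w)).
have wyw' k : bform B (y ^+ k *m w) w = 0 by rewrite bformC.
have vyw k : bform B (y ^+ k *m w) v = 0 by rewrite bformC // bform_expr_v.
(* Both factors are orthogonal to [v] and [w], so the wedge kills these. Were the factors
   proportional, applying [y] would give [y ^+ e.+1 *m w = 0]. *)
split; rewrite ?wedge_so // ?wedge_mul // ?wyw' ?vyw ?scale0r ?subr0 //.
  apply/eqP => /(wedge_eq0 Bunit l0)[k /(congr1 (mulmx y))].
  by rewrite -scalemxAr !ySl ye scaler0 => l0'; rewrite l0' eqxx in l0.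
(* In the bracket with [y], one term has the factor [y ^+ e.+2 *m w = 0] and the other is the wedge
   of a vector with itself. *)
apply/eqP; rewrite -subr_eq0 bracket_wedge // !ySl ye.
by rewrite /wedge trmx0 !mul0mx !mulmx0 !subrr addr0.
Qed.

(** By the derivation rule, [z] commutes with [wedge B w v] because it kills both factors. *)
Lemma comm_add_wedge x y z v w k : x = y + k *: wedge B w v -> z \in so B ->
  z *m v = 0 -> z *m w = 0 -> y *m z = z *m y -> x *m z = z *m x.
Proof.
move=> -> zso zv zw yz; rewrite mulmxDl mulmxDr yz -scalemxAl -scalemxAr.
congr (_ + _ *: _); apply/eqP; rewrite eq_sym -subr_eq0 bracket_wedge // zv zw.
by rewrite /wedge trmx0 !mul0mx !mulmx0 !subrr addr0.
Qed.

Lemma strongly_regular_comm_eq0 v x z : strongly_regular B v x ->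
  z \in so_k B v -> proj_k B v x *m z = z *m proj_k B v x -> x *m z = z *m x ->
  z = 0.
Proof.
move=> sreg zk yz xz; have /andP[zso _] : (z \in so B) && (z *m v == 0).
  by rewrite -mem_so_k.
have : z \in (centralizer (so_k B v) (proj_k B v x) :&: centralizer (so B) x)%VS.
  by apply/memv_capP; split; rewrite mem_centralizer ?zk ?zso ?yz ?xz ?eqxx.
by rewrite sreg memv0 => /eqP.
Qed.

End CommutingElement.

Theorem corollary4p25 (R : realType) (n : nat) (B : 'M[R[i]]_n) (v : 'cV[R[i]]_n)
    (fk : 'I_(n.-1)./2 -> 'M[R[i]]_n -> R[i]) (f : 'I_n./2 -> 'M[R[i]]_n -> R[i]) :
  (3 < n)%N ->
  B^T = B -> B \in unitmx -> bform B v v != 0 ->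
  free_invariant_generators (SO_K B v) (so_k B v) fk ->
  free_invariant_generators (SO B) (so B) f ->
  forall x : 'M[R[i]]_n, x \in so B ->
    partial_KW B v fk f x = (0, 0) -> ~ strongly_regular B v x.
Proof.
(* Size [n.+1] gives the matrices a ring structure, needed for the powers of [x] and [y]. *)
case: n B v fk f => // n B v fk f n3 Bsym Bunit vB fkgen fgen x xso [].
move=> /rowP fk0 /rowP f0 sreg.
set y := proj_k B v x; set w := x *m v.
have yk : y \in so_k B v by exact: memv_pi.
have SOu : {subset SO B <= unitmx}.
  by move=> g /andP[_ /eqP dg]; rewrite unitmxE dg unitr1.
have SOKu : {subset SO_K B v <= unitmx} by move=> g /andP[/SOu].
have xn : x ^+ n.+1 = 0.
  apply/char_poly_nilpotent/(char_poly_zero_fibre SOu fgen xso) => i.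
  by have := f0 i; rewrite !mxE.
have yn : y ^+ n.+1 = 0.
  apply/char_poly_nilpotent/(char_poly_zero_fibre SOKu fkgen yk) => i.
  by have := fk0 i; rewrite !mxE.
have [yso /eqP yv] : y \in so B /\ y *m v == 0.
  by apply/andP; rewrite -mem_so_k.
have wv : bform B w v = 0.
  have /eqP := bform_so v v xso; rewrite -/w (bformC Bsym v).
  by rewrite -subr_eq0 opprK -mulr2n mulrn_eq0 => /eqP.
have xE : x = y + (bform B v v)^-1 *: wedge B w v by exact: proj_kE_wedge.
have wyw k := cyclic_isotropic Bsym vB yso yv wv xE k xn yn.
have [z [z0 zso zv zw yz]] :=
  exists_commuting_so_annihilator Bsym Bunit n3 yso yv wv yn wyw.
have zk : z \in so_k B v by rewrite mem_so_k zso zv eqxx.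
have xz := comm_add_wedge xE zso zv zw yz.
by move: z0; rewrite (strongly_regular_comm_eq0 sreg zk yz xz) eqxx.
Qed.
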